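(* Let $X$ be a metric space and let $T\subseteq X$ be a non-meagre set with the Baire property. Let $G$ be a group equipped with a right-invariant metric under which $G$ is a Baire space, and let $\varphi:G\times X\to X$ be a separately continuous, transitive Nikodym action of $G$ on $X$ (write $gx=g(x)=\varphi(g,x)$). Then for every convergent sequence $x_n\to x$ in $X$ and every non-meagre set $A\subseteq G$ with the Baire property such that $e_G\in A^{q}$ and $A^{q}x\cap T^{q}\neq\emptyset$, there exist $\alpha\in A$ and an integer $N$ such that $\alpha x\in T$ and \[\{\alpha(x_n):n>N\}\subseteq T.\] Moreover, the same conclusion holds if, in place of the Nikodym property of the action, one assumes that $G$ is analytic and all point-evaluation maps $\varphi_x:g\mapsto\varphi(g,x)$ are base-$\sigma$-discrete.
   Context: All spaces are metrizable (not necessarily separable). A group action $\varphi:G\times X\to X$ satisfies $\varphi(e_G,x)=x$ and $\varphi(gh,x)=\varphi(g,\varphi(h,x))$. It is separately continuous if $x\mapsto\varphi(g,x)$ is continuous for each $g$ and $\varphi_x:g\mapsto\varphi(g,x)$ is continuous for each $x$; transitive if for all $x,y\in X$ there is $g$ with $g(x)=y$. For $U\subseteq G$, $Ux=\{u(x):u\in U\}$. The action is a Nikodym action if for every non-empty open neighbourhood $U$ of $e_G$ and every $x\in X$, the set $Ux$ contains a non-meagre set with the Baire property. A set is ''Baire'' if it has the Baire property. The quasi-interior $A^{q}$ of a set $A$ is the largest open set $U$ with $U\setminus A$ meagre. A metrizable space is (absolutely) analytic if it embeds in its own metric completion as a Souslin-$\mathcal F$ set, i.e. a set of the form $\bigcup_{i\in\mathbb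 N^{\mathbb N}}\bigcap_{n}H(i|n)$ with each $H(i|n)$ closed, where $i|n=(i_1,\dots,i_n)$. A family of sets is discrete if every point has a neighbourhood meeting at most one member; $\sigma$-discrete if it is a countable union of discrete families; a family $\mathcal B$ is a base for a family $\mathcal A$ if each member of $\mathcal A$ is a union of members of $\mathcal B$. A map $f:X\to Y$ is base-$\sigma$-discrete if for every discrete family $\mathcal E$ in $X$, the family $\{f(E):E\in\mathcal E\}$ has a $\sigma$-discrete base in $Y$. *)

(* Defs.v *)
From HB Require Import structures.
From mathcomp Require Import all_boot all_order all_algebra.
From mathcomp Require Import all_classical all_reals topology normedtype.
Set Implicit Arguments. Unset Strict Implicit. Unset Printing Implicit Defensive.
Import Order.TTheory GRing.Theory Num.Theory.
Local Open Scope classical_set_scope.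
Local Open Scope ring_scope.

Section Category.
Context {T : topologicalType}.

Definition nowhere_dense (A : set T) : Prop := interior (closure A) = set0.

Definition meagre (A : set T) : Prop :=
  exists F : nat -> set T, (forall n, nowhere_dense (F n)) /\ A `<=` \bigcup_n F n.

Definition baire_prop (A : set T) : Prop :=
  exists U : set T, open U /\ meagre ((A `\` U) `|` (U `\` A)).

Definition baire_space : Prop :=
  forall U : set T, open U -> U !=set0 -> ~ meagre U.

(* quasi-interior: the union of all open U with U \ A meagre
   (by Banach's category theorem this is the largest such open set) *)
Definition quasi_interior (A : set T) : set T :=
  \bigcup_(U in [set U : set T | open U /\ meagre (U `\` A)]) U.

Definition discrete_family (F : set (set T)) : Prop :=
  forall x : T, exists2 V, nbhs x V &
    forall A B, F A -> F B -> A `&` V !=set0 -> B `&` V !=set0 -> A = B.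

Definition sigma_discrete (F : set (set T)) : Prop :=
  exists Fn : nat -> set (set T),
    (forall n, discrete_family (Fn n)) /\ F = \bigcup_n Fn n.

Definition is_base_for (B A : set (set T)) : Prop :=
  forall A0, A A0 -> exists2 B0 : set (set T), B0 `<=` B & A0 = \bigcup_(S in B0) S.

Definition souslin_F (S : set T) : Prop :=
  exists H : seq nat -> set T, (forall s, closed (H s)) /\
    S = \bigcup_(i in [set: nat -> nat]) \bigcap_n H (mkseq i n.+1).
End Category.

Definition base_sigma_discrete {X Y : topologicalType} (f : X -> Y) : Prop :=
  forall E : set (set X), discrete_family E ->
    exists2 B : set (set Y), sigma_discrete B & is_base_for B [set f @` S | S in E].

Definition metric_for {R : realType} {T : pseudoMetricType R} (d : T -> T -> R) : Prop :=
  [/\ forall x y, (d x y = 0) <-> x = y,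
      forall x y, d x y = d y x,
      forall x y z, d x z <= d x y + d y z &
      forall x (e : R), 0 < e -> forall y, ball x e y <-> d x y < e].

(* a metric space is analytic if it embeds (isometrically) in its metric
   completion as a Souslin-F set; equivalently in some complete metric
   space containing an isometric copy of it *)
Definition analytic_metric {R : realType} {T : pseudoMetricType R} (d : T -> T -> R) : Prop :=
  exists (Y : completePseudoMetricType R) (dY : Y -> Y -> R) (i : T -> Y),
    metric_for dY /\ (forall a b, dY (i a) (i b) = d a b) /\ souslin_F (range i).

Definition is_group {G : Type} (mul : G -> G -> G) (inv : G -> G) (e : G) : Prop :=
  [/\ forall a b c, mul a (mul b c) = mul (mul a b) c,
      forall a, mul e a = a, forall a, mul a e = a,
      forall a, mul (inv a) a = e & forall a, mul a (inv a) = e].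

Definition right_invariant {R : realType} {G : Type} (mul : G -> G -> G)
  (d : G -> G -> R) : Prop := forall g h k, d (mul g k) (mul h k) = d g h.

Definition is_action {G X : Type} (mul : G -> G -> G) (e : G) (phi : G -> X -> X) : Prop :=
  (forall x, phi e x = x) /\ (forall g h x, phi (mul g h) x = phi g (phi h x)).

Definition separately_continuous {G X : topologicalType} (phi : G -> X -> X) : Prop :=
  (forall g, continuous (phi g)) /\ (forall x, continuous (fun g => phi g x)).

Definition transitive_action {G X : Type} (phi : G -> X -> X) : Prop :=
  forall x y, exists g, phi g x = y.

Definition orbit_of {G X : Type} (phi : G -> X -> X) (U : set G) (x : X) : set X :=
  [set phi u x | u in U].

Definition nikodym_action {G X : topologicalType} (e : G) (phi : G -> X -> X) : Prop :=
  forall U : set G, open U -> U e -> forall x : X,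
    exists2 B : set X, B `<=` orbit_of phi U x & ~ meagre B /\ baire_prop B.

(* Main.v *)
Require Import Defs.
From HB Require Import structures.
From mathcomp Require Import all_boot all_order all_algebra.
From mathcomp Require Import all_classical all_reals topology normedtype.
From mathcomp Require Import lra wochoice.
Import Order.TTheory GRing.Theory Num.Theory.
Local Open Scope classical_set_scope.
Local Open Scope ring_scope.

(** Both cases reduce to one property: for every ball [V] about [e] and every
  point [w], the set [V w] is not nowhere dense. Granting it, [{g | g v \in F}]
  is nowhere dense for every [v] and every nowhere dense [F], and [alpha] is any
  point of a suitable non-empty open set off countably many such sets.

  A Nikodym action has the property at once. In the analytic case, left
  translations of [G] may be discontinuous, so the property does not simply
  travel along orbits. Suppose [V w] is nowhere dense. A localization argument
  for base-sigma-discrete maps shows that, off a meagre set, every point [z] is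
  "fat": [W z] is non-meagre for all balls [W] about [e]. Write [w = d z] and let
  [M] be the closed nowhere dense set [d^-1 (closure (V w))]. If [d p] and [d q]
  are closer than the radius of [V], then [p q^-1 z \in M], and
  [{p | p q^-1 z \in M}] is closed and usually nowhere dense, since
  [v |-> v^-1 z] is continuous and [z] is fat. Closing off under countably many
  choices gives a countable [C] whose closure [P] is a Baire space on which these
  sets, and the fibres of [p |-> p x] for a suitable [x = h^-1 z], are nowhere
  dense. A maximal [J] in [P] such that the [d p] are uniformly separated and the
  [p x] distinct is countable, because the singletons [{d p x}] form a
  sigma-discrete family in a separable set; but then the Baire property of [P]
  yields a further element for [J]. *)

(** * Meagre sets and discrete families *)

Section MeagreSets.
Set Implicit Arguments. Unset Strict Implicit. Unset Printing Implicit Defensive.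
Context {T : topologicalType}.
Implicit Types (A B : set T) (F : set (set T)).

Lemma nowhere_dense_sub A B : A `<=` B -> nowhere_dense B -> nowhere_dense A.
Proof.
move=> AB; rewrite /nowhere_dense -!subset0 => B0.
by apply: subset_trans B0; apply: interiorS; apply: closureS.
Qed.

Lemma nowhere_dense_meagre A : nowhere_dense A -> meagre A.
Proof. by move=> A0; exists (fun=> A); split => // x Ax; exists 0%N. Qed.

Lemma meagre_sub A B : A `<=` B -> meagre B -> meagre A.
Proof. by move=> AB [F [F0 BF]]; exists F; split=> //; apply: subset_trans BF. Qed.

Lemma meagre_bigcup (A : nat -> set T) :
  (forall n, meagre (A n)) -> meagre (\bigcup_n A n).
Proof.
move=> /choice[F FP].
exists (fun n => if @unpickle (nat * nat)%type n is Some p then F p.1 p.2 else set0).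
split=> [n|x [n _ Anx]].
  case: unpickle => [p|]; first exact: (FP _).1.
  by rewrite /nowhere_dense closure0 interior0.
have [k _ Fx] := (FP n).2 x Anx.
by exists (pickle (n, k)); rewrite // pickleK.
Qed.

Lemma meagre0 : @meagre T set0.
Proof. by exists (fun=> set0); split=> // n; rewrite /nowhere_dense closure0 interior0. Qed.

Lemma meagreU A B : meagre A -> meagre B -> meagre (A `|` B).
Proof.
move=> mA mB; apply: (@meagre_sub _ (\bigcup_n (if n is 0%N then A else B))).
  by move=> x [Ax|Bx]; [exists 0%N|exists 1%N].
by apply: meagre_bigcup => -[|n].
Qed.

(** Each point has a neighbourhood meeting at most one member of the family, and there the closure
    of the union is the closure of a single [N S]. *)
Lemma nowhere_dense_discrete_bigcup F (N : set T -> set T) :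
  discrete_family F -> (forall S, F S -> N S `<=` S) ->
  (forall S, F S -> nowhere_dense (N S)) ->
  nowhere_dense (\bigcup_(S in F) N S).
Proof.
move=> dF NS N0; rewrite /nowhere_dense -subset0 => x xi.
have [V Vx VF] := dF x.
have W : nbhs x (V° `&` (closure (\bigcup_(S in F) N S))°).
  by apply: filterI; apply: nbhs_interior.
have xc : closure (\bigcup_(S in F) N S) x by exact: interior_subset.
have [y [[S0 FS0 yS0] [yV _]]] := xc _ W.
suff : (closure (N S0))° x by rewrite (N0 _ FS0).
apply: (filterS _ W) => p [pV pc] O Op.
have [q [[S FS qS] [qO qV]]] : (\bigcup_(S in F) N S) `&` (O `&` V°) !=set0.
  apply: (interior_subset pc); apply: filterI => //.
  by apply: open_nbhs_nbhs; split=> //; apply: open_interior.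
have SS0 : S = S0.
  apply: VF => //; [exists q|exists y]; split; try exact: interior_subset.
    exact: NS qS.
  exact: NS yS0.
by exists q; split=> //; rewrite -SS0.
Qed.

(** Group the nowhere dense pieces by index: for each [n] the [n]-th pieces of all members, cut down
    to those members, have a nowhere dense union. *)
Lemma meagre_discrete_bigcup F :
  discrete_family F -> (forall S, F S -> meagre S) -> meagre (\bigcup_(S in F) S).
Proof.
move=> dF mF.
have /choice[N NP] : forall S, exists N : nat -> set T,
    F S -> (forall n, nowhere_dense (N n)) /\ S `<=` \bigcup_n N n.
  move=> S; have [/mF[N NP]|nF] := pselect (F S); first by exists N.
  by exists (fun=> set0).
apply: (@meagre_sub _ (\bigcup_n \bigcup_(S in F) (N S n `&` S))).
  move=> x [S FS Sx]; have [n _ Nx] := (NP S FS).2 x Sx.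
  by exists n => //; exists S.
apply: meagre_bigcup => n; apply: nowhere_dense_meagre.
apply: (@nowhere_dense_discrete_bigcup F (fun S => N S n `&` S)) => // S FS.
apply: (nowhere_dense_sub (@subIsetl _ _ _)); exact: (NP S FS).1.
Qed.

Lemma discrete_family_sub F F' : F' `<=` F -> discrete_family F -> discrete_family F'.
Proof.
move=> sF dF x; have [V Vx VF] := dF x; exists V => // A B FA FB.
by apply: VF; apply: sF.
Qed.

Lemma meagre_sigma_discrete_bigcup F :
  sigma_discrete F -> (forall S, F S -> meagre S) -> meagre (\bigcup_(S in F) S).
Proof.
move=> [Fn [dF ->]] mF; rewrite bigcup_bigcup; apply: meagre_bigcup => n.
by apply: meagre_discrete_bigcup => // S FS; apply: mF; exists n.
Qed.

Lemma sigma_discrete_sub F F' : F' `<=` F -> sigma_discrete F -> sigma_discrete F'.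
Proof.
move=> sF [Fn [dF FE]]; exists (fun n => F' `&` Fn n); split.
  by move=> n; apply: discrete_family_sub (dF n); apply: subIsetr.
rewrite -setI_bigcupr -FE; apply/esym/setIidPl; exact: sF.
Qed.

(** For the identity, localization of meagreness becomes Banach's category theorem. *)
Lemma base_sigma_discrete_id : base_sigma_discrete (@id T).
Proof.
move=> E dE; exists E.
  by exists (fun=> E); split=> //; rewrite eqEsubset; split=> [S ES|S [n _]//]; exists 0%N.
move=> A [S ES <-]; exists [set S]; last by rewrite bigcup_set1 image_id.
by move=> _ ->.
Qed.

End MeagreSets.

Lemma nowhere_dense_preimage {S T : topologicalType} (f : S -> T) (g : T -> S) (A : set T) :
  continuous f -> continuous g -> cancel f g -> cancel g f ->
  nowhere_dense A -> nowhere_dense (f @^-1` A).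
Proof.
move=> cf cg fK gK A0; rewrite /nowhere_dense -subset0 => x xi.
suff : (closure A)° (f x) by rewrite A0.
have W : nbhs (f x) (g @^-1` (closure (f @^-1` A))).
  apply: cg; rewrite fK; exact: xi.
apply: (filterS _ W) => y yc O Oy.
have : nbhs (g y) (f @^-1` O) by apply: cf; rewrite gK.
move=> /yc[p [Ap Op]]; by exists (f p).
Qed.

Lemma meagre_preimage {S T : topologicalType} (f : S -> T) (g : T -> S) (A : set T) :
  continuous f -> continuous g -> cancel f g -> cancel g f ->
  meagre A -> meagre (f @^-1` A).
Proof.
move=> cf cg fK gK [F [F0 AF]]; exists (fun n => f @^-1` F n); split.
  by move=> n; apply: nowhere_dense_preimage (F0 n).
by rewrite -preimage_bigcup; apply: preimage_subset.
Qed.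

(** * Localization of meagreness under base-sigma-discrete maps *)

Section Localization.
Set Implicit Arguments. Unset Strict Implicit. Unset Printing Implicit Defensive.
Context {R : realType} {G : pseudoMetricType R} {X : topologicalType}.

Definition nradius (n : nat) : R := n.+1%:R^-1.

Lemma nradius_gt0 n : 0 < nradius n. Proof. by rewrite invr_gt0. Qed.

Lemma nradius_lt (r : R) : 0 < r -> exists n, nradius n < r.
Proof.
move=> r0; exists (Num.truncn r^-1).
rewrite /nradius invf_plt ?posrE ?ltr0n //; exact: truncnS_gt.
Qed.

Section Metric.
Context {M : pseudoMetricType R} {d : M -> M -> R} (md : metric_for d).

Lemma metric_ballP (x y : M) (e : R) : 0 < e -> ball x e y <-> d x y < e.
Proof. by case: md => _ _ _ h /h. Qed.

Lemma metric_eq0 (x y : M) : (forall e : R, 0 < e -> ball x e y) -> x = y.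
Proof.
case: md => d0 dC dT _ xy; apply/d0; apply/eqP; rewrite eq_le; apply/andP; split.
  apply/ler_addgt0Pr => e e0; rewrite add0r; apply/ltW/metric_ballP => //; exact: xy.
have := dT x y x; rewrite (d0 x x).2// (dC y x); lra.
Qed.

Lemma ball_interior (a x : M) (r : R) : ball a r x -> 0 < r ->
  exists k, ball x (nradius k) `<=` ball a r.
Proof.
move=> ax r0; have {}ax := (metric_ballP _ _ r0).1 ax.
have [|k kr] := @nradius_lt (r - d a x); first by rewrite subr_gt0.
exists k => y /(metric_ballP _ _ (nradius_gt0 k)) xy; apply/metric_ballP => //.
by case: md => _ _ dT _; have := dT a x y; lra.
Qed.

Lemma open_metric_ball (a : M) (r : R) : 0 < r -> open (ball a r).
Proof.
move=> r0; rewrite openE => x ax; have [k kP] := ball_interior ax r0.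
by apply: filterS kP _; apply: nbhsx_ballx; apply: nradius_gt0.
Qed.

Lemma nbhs_nradiusP (x : M) (A : set M) : nbhs x A <-> exists k, ball x (nradius k) `<=` A.
Proof.
split=> [/nbhs_ballP[r /= r0 rA]|[k kA]].
  have [k kr] := nradius_lt r0; exists k; apply: subset_trans rA.
  by apply: le_ball; apply: ltW.
by apply: filterS kA _; apply: nbhsx_ballx; apply: nradius_gt0.
Qed.

End Metric.

(* Stone's decomposition: assign to each point the least centre whose ball
   contains it, and split according to how deep it lies in that ball. *)
Lemma meagre_localization (d : G -> G -> R) (f : G -> X) (A : set G) : metric_for d ->
  base_sigma_discrete f ->
  (forall a, A a -> exists2 r : R, 0 < r & meagre (f @` (A `&` ball a r))) ->
  meagre (f @` A).
Proof.
move=> md bf locA.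
(* On each [An n] a single radius serves all points. *)
pose An n := [set a | A a /\ meagre (f @` (A `&` ball a (nradius n)))].
have AE : A `<=` \bigcup_n An n.
  move=> a Aa; have [r r0 mr] := locA a Aa.
  have [n nr] := nradius_lt r0; exists n => //; split=> //.
  apply: meagre_sub mr; apply: image_subset; apply: setIS.
  by apply: le_ball; apply: ltW.
apply: (@meagre_sub _ _ (\bigcup_n f @` (An n))).
  by move=> _ [a /AE[n _ Ana] <-]; exists n => //; exists a.
apply: meagre_bigcup => n.
have [le wo] := well_ordering_principle G.
have /choice[m mP] : forall x : G, exists c, (An n x) ->
    [/\ An n c, ball c (nradius n) x &
        forall b, An n b -> ball b (nradius n) x -> le c b].
  move=> x; have [Ax|nAx] := pselect (An n x); last by exists x.
  have [|c [[cP cmin] _]] := wo (mem [set b | An n b /\ ball b (nradius n) x]).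
    exists x; rewrite inE; split=> //; apply: ballxx; exact: nradius_gt0.
  exists c => _; move: cP; rewrite inE => -[Anc bc]; split=> // b Anb bb.
  by apply: cmin; rewrite inE.
have wo' : wo_chain le (mem [set: G]) by move=> B _; exact: wo.
have le_tot a b : le a b || le b a by apply: (wo_chainW wo'); rewrite inE.
have le_anti a b : le a b -> le b a -> a = b.
  by move=> ab ba; apply: (wo_chain_antisymmetric wo'); rewrite ?inE ?ab.
pose E k a := [set x | [/\ An n x, m x = a &
  ball x (nradius k) `<=` ball a (nradius n)]].
apply: (@meagre_sub _ _ (\bigcup_k \bigcup_a f @` (E k a))).
  move=> _ [x Ax <-]; have [_ mx _] := mP x Ax.
  have [k kP] : exists k, ball x (nradius k) `<=` ball (m x) (nradius n).
    by apply: (ball_interior md) => //; apply: nradius_gt0.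
  by exists k => //; exists (m x) => //; exists x.
apply: meagre_bigcup => k.
have dE : discrete_family (range (E k)).
  move=> p; exists (ball p (nradius k / 2)).
    by apply: nbhsx_ballx; rewrite divr_gt0 ?nradius_gt0.
  move=> _ _ [a _ <-] [b _ <-] [x [[Ax <- xE] px]] [y [[Ay <- yE] py]].
  have [xy yx] : ball x (nradius k) y /\ ball y (nradius k) x.
    by split; apply: (@ball_splitr _ _ p).
  (* Points closer than [nradius k] lie in the balls about each other's centres, so each of the two
     least centres is below the other. *)
  congr (E k _); have [mx bx lex] := mP x Ax; have [my by_ ley] := mP y Ay.
  by apply: le_anti; [apply: lex => //; apply: yE|apply: ley => //; apply: xE].
have [B sB BE] := bf _ dE.
(* The meagre members of the base suffice: a member inside the image of [E k a] is meagre, because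
   [E k a] lies in the ball of radius [nradius n] about [a], a point of [An n]. *)
apply: (@meagre_sub _ _ (\bigcup_(S in B `&` [set S | meagre S]) S)); last first.
  apply: meagre_sigma_discrete_bigcup => [|S []//].
  exact: sigma_discrete_sub (@subIsetl _ _ _) sB.
move=> _ [a _ [x Ex <-]].
have [|B0 B0B B0E] := BE (f @` (E k a)); first by exists (E k a) => //; exists a.
have : (f @` (E k a)) (f x) by exists x.
rewrite B0E => -[S B0S Sfx]; exists S => //; split; first exact: B0B.
case: Ex => Anx mxa _; have [[_ ma] _ _] := mP x Anx.
apply: meagre_sub ma; apply: subset_trans (_ : f @` (E k a) `<=` _).
  by rewrite B0E => y Sy; exists S.
move=> _ [y [Ay mya _] <-]; exists y => //; split; first by have [] := Ay.
by rewrite mxa -mya; have [] := mP y Ay.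
Qed.

End Localization.

(** * A Baire category argument in analytic Baire spaces *)

Section SouslinPieces.
Set Implicit Arguments. Unset Strict Implicit. Unset Printing Implicit Defensive.
Context {R : realType} {G : pseudoMetricType R} {dG : G -> G -> R}.
Context {Y : completePseudoMetricType R} {dY : Y -> Y -> R} {i : G -> Y}.
Context {H : seq nat -> set Y}.
Hypotheses (mG : metric_for dG) (mY : metric_for dY).
Hypothesis iso : forall a b, dY (i a) (i b) = dG a b.
Hypothesis Hcl : forall s, closed (H s).
Hypothesis iH : range i = \bigcup_(t in [set: nat -> nat]) \bigcap_n H (mkseq t n.+1).
Hypothesis hbaire : @baire_space G.

Local Notation nradius := (@nradius R).

Definition souslin_piece (s : seq nat) : set G :=
  [set g | exists t : nat -> nat, mkseq t (size s) = s /\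
     forall n, H (mkseq t n.+1) (i g)].

(** Non-meagreness is asked in every ball inside [W], so that it passes to smaller balls during the
    construction. *)
Definition large (s : seq nat) (W : set G) : Prop :=
  forall a r, 0 < r -> ball a r `<=` W -> ~ meagre (ball a r `&` souslin_piece s).

Lemma large_sub s W W' : W' `<=` W -> large s W -> large s W'.
Proof. by move=> WW' lW a r r0 aW'; apply: lW => //; apply: subset_trans WW'. Qed.

Lemma large_nil W : large [::] W.
Proof.
move=> a r r0 _; rewrite (_ : souslin_piece [::] = setT) ?setIT.
  apply: hbaire; first exact: (open_metric_ball mG).
  by exists a; apply: ballxx.
rewrite -subTset => g _.
have : range i (i g) by exists g.
by rewrite iH => -[t _ tP]; exists t; split=> // n; apply: tP.
Qed.

Lemma souslin_piece_rcons s : souslin_piece s `<=` \bigcup_k souslin_piece (rcons s k).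
Proof.
move=> g [t [ts tP]]; exists (t (size s)) => //; exists t; split=> //.
by rewrite size_rcons mkseqS ts.
Qed.

(** Countably many successor pieces cover the piece of [s], so one of them is non-meagre in the
    ball. Discarding the points where it is locally meagre costs only a meagre set, and the
    remainder is dense in some ball. *)
Lemma large_extend s c r : 0 < r -> large s (ball c r) ->
  exists k a m, ball a (nradius m) `<=` ball c r /\
                large (rcons s k) (ball a (nradius m)).
Proof.
move=> r0 lsc.
have [k kP] : exists k, ~ meagre (ball c r `&` souslin_piece (rcons s k)).
  apply: contrapT => /forallNP nk; apply: (lsc c r r0 (fun x h => h)).
  apply: (@meagre_sub _ _ (\bigcup_k (ball c r `&` souslin_piece (rcons s k)))).
    by move=> g [cg /souslin_piece_rcons[k _ kg]]; exists k.
  by apply: meagre_bigcup => k; apply: contrapT; apply: nk.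
exists k; apply: contrapT => /forallNP na; apply: kP.
set A := _ `&` _.
pose O := [set g | exists2 q : R, 0 < q & meagre (A `&` ball g q)].
apply: (@meagre_sub _ _ ((A `&` O) `|` (A `\` O))).
  by move=> g Ag; have [Og|nOg] := pselect (O g); [left|right].
apply: meagreU.
  rewrite -[A `&` O]image_id.
  apply: (meagre_localization mG base_sigma_discrete_id) => a [Aa [q q0 mq]].
  by exists q; rewrite // image_id; apply: meagre_sub mq => x [[? _] ?].
apply: nowhere_dense_meagre; rewrite /nowhere_dense -subset0 => y yi.
have [g [[Ag nOg] gi]] : (A `\` O) `&` (closure (A `\` O))° !=set0.
  by apply: (interior_subset yi); apply: open_nbhs_nbhs; split=> //; exact: open_interior.
have [m mP] : exists m, ball g (nradius m) `<=` ball c r `&` closure (A `\` O).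
  apply/nbhs_nradiusP; apply: filterI => //.
  by apply: open_nbhs_nbhs; split; [exact: (open_metric_ball mG)|case: Ag].
(* As the ball about [g] is not large, some ball inside it meets the piece in a meagre set; yet a
   point of [A] outside [O] lies there. *)
have /existsNP[a /existsNP[q /not_implyP[q0 /not_implyP[aq /contrapT mq]]]] :
    ~ large (rcons s k) (ball g (nradius m)).
  by move=> lg; apply: (na g); exists m; split=> // x /mP[].
have [g' [[Ag' nOg'] ag']] : (A `\` O) `&` ball a q !=set0.
  have /aq/mP[_ ac] := @ballxx _ _ a q q0.
  apply: ac; exact: nbhsx_ballx.
apply: nOg'; have [l lP] := ball_interior mG ag' q0.
exists (nradius l); first exact: nradius_gt0.
by apply: meagre_sub mq => x [[_ Ax] /lP].
Qed.

Context {C : set G} (g0 : G) (Cg0 : C g0).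
Hypothesis C_large : forall c m s, C c -> large s (ball c (nradius m)) ->
  exists k c' m', [/\ C c', ball c' (nradius m') `<=` ball c (nradius m) &
                      large (rcons s k) (ball c' (nradius m'))].

(** For closed [F] this says that [F] is nowhere dense relative to the closure of [C]. It is phrased
    through points of [C] because the construction takes its centres there. *)
Definition thin (F : set G) : Prop :=
  closed F /\ forall c m, C c -> exists c', [/\ C c', ball c (nradius m) c' & ~ F c'].

(** One stage of the construction: leave [F], shrink the ball and fix one more coordinate of the
    branch, keeping the centre in [C]. *)
Lemma thin_step n F (st : G * nat * seq nat) : thin F ->
  C st.1.1 /\ large st.2 (ball st.1.1 (nradius st.1.2)) ->
  exists st' : G * nat * seq nat,
    [/\ C st'.1.1 /\ large st'.2 (ball st'.1.1 (nradius st'.1.2)),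
        exists k, st'.2 = rcons st.2 k,
        ball st'.1.1 (nradius st'.1.2) `<=` ball st.1.1 (nradius st.1.2) &
        exists a q, [/\ 0 < q, q <= nradius n,
          ball st'.1.1 (nradius st'.1.2) `<=` ball a q & ball a (2 * q) `<=` ~` F]].
Proof.
case: st => [[c m] s] /= [cF tF] [Cc lc].
have [c1 [Cc1 cc1 nFc1]] := tF c m Cc.
have [k1 k1P] := ball_interior mG cc1 (nradius_gt0 m).
have [k2 k2P] : exists k, ball c1 (nradius k) `<=` ~` F.
  apply/nbhs_nradiusP; apply: open_nbhs_nbhs; split=> //.
  by rewrite openC.
(* The three bounds keep the new ball in the old one, keep the ball of radius [2 * q] off [F], and
   force the radii to zero. *)
pose q := Num.min (nradius k1 / 2) (Num.min (nradius k2 / 2) (nradius n)).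
have q0 : 0 < q by rewrite !lt_min !divr_gt0 ?nradius_gt0.
have [m1 m1q] := @nradius_lt R q q0.
have sub1 : ball c1 (nradius m1) `<=` ball c (nradius m).
  apply: subset_trans k1P; apply: le_ball.
  have : q <= nradius k1 / 2 by rewrite /q ge_min lexx.
  by have := @nradius_gt0 R k1; lra.
have [k [c' [m' [Cc' sub2 lc']]]] := C_large Cc1 (large_sub sub1 lc).
exists (c', m', rcons s k); split=> //=.
- by exists k.
- exact: subset_trans sub1.
exists c1, q; split=> //.
- by rewrite /q !ge_min lexx !orbT.
- by apply: subset_trans sub2 _; apply: le_ball; apply: ltW.
apply: subset_trans k2P; apply: le_ball.
have : q <= nradius k2 / 2 by rewrite /q !ge_min lexx !orbT.
lra.
Qed.

(* The closure of [C] is not covered by countably many thin sets, although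
   neither [G] nor that closure need be complete. *)
Lemma thin_avoidance (F : nat -> set G) : (forall n, thin (F n)) ->
  exists p, closure C p /\ forall n, ~ F n p.
Proof.
move=> tF.
pose valid (st : G * nat * seq nat) :=
  C st.1.1 /\ large st.2 (ball st.1.1 (nradius st.1.2)).
pose good n (st st' : G * nat * seq nat) :=
    [/\ valid st',
        exists k, st'.2 = rcons st.2 k,
        ball st'.1.1 (nradius st'.1.2) `<=` ball st.1.1 (nradius st.1.2) &
        exists a q, [/\ 0 < q, q <= nradius n,
          ball st'.1.1 (nradius st'.1.2) `<=` ball a q & ball a (2 * q) `<=` ~` F n]].
have /choice[step stepP] : forall x : nat * (G * nat * seq nat),
    exists st', valid x.2 -> good x.1 x.2 st'.
  move=> [n st]; have [vst|nv] := pselect (valid st); last by exists st.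
  by have [st' st'P] := @thin_step n _ _ (tF n) vst; exists st'.
pose st := fix st n := if n is k.+1 then step (k, st k) else (g0, 0%N, [::]).
have stV n : valid (st n).
  elim: n => [|n IHn]; first by split=> //; apply: large_nil.
  by have [] := stepP (n, st n) IHn.
have stS n : good n (st n) (st n.+1) by exact: (stepP (n, st n) (stV n)).
have /choice[aq aqP] : forall n, exists aq : G * R, [/\ 0 < aq.2, aq.2 <= nradius n,
    ball (st n.+1).1.1 (nradius (st n.+1).1.2) `<=` ball aq.1 aq.2 &
    ball aq.1 (2 * aq.2) `<=` ~` F n].
  by move=> n; have [_ _ _ [a [q aqP]]] := stS n; exists (a, q).
(* Largeness makes the piece meet the ball; the chosen points need not belong to [C]. *)
have /choice[g gP] : forall n, exists g,
    ball (st n).1.1 (nradius (st n).1.2) g /\ souslin_piece (st n).2 g.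
  move=> n; apply: contrapT => ng; have [_ l] := stV n.
  apply: (l _ _ (@nradius_gt0 R _) (fun x h => h)).
  by apply: meagre_sub (@meagre0 _) => x [? ?]; apply: ng; exists x.
have nest m n : (m <= n)%N -> ball (st n).1.1 (nradius (st n).1.2) `<=`
    ball (st m).1.1 (nradius (st m).1.2).
  elim: n => [|n IHn]; first by rewrite leqn0 => /eqP->.
  rewrite leq_eqVlt => /orP[/eqP->//|]; rewrite ltnS => /IHn; apply: subset_trans.
  by have [] := stS n.
have gball m n : (m < n)%N -> ball (aq m).1 (aq m).2 (g n).
  move=> mn; have [_ _ + _] := aqP m; apply; apply: (nest m.+1 n mn).
  by have [] := gP n.
have [_ dYC dYT _] := mY; have [_ dGC dGT _] := mG.
have : cauchy ((i \o g) @ \oo).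
  apply: cauchy_exP => e e0; have [n ne] := @nradius_lt R (e / 2) ltac:(lra).
  exists (i (aq n).1); exists n.+1 => // k /= nk; apply/(metric_ballP mY) => //.
  have [aq0 aqn _ _] := aqP n.
  by rewrite iso; have /(metric_ballP mG _ _ aq0) := gball n k nk; lra.
move=> /cauchy_cvgP; set y := lim _ => gy.
pose t n := nth 0%N (st n.+1).2 n.
have tE n : mkseq t n = (st n).2.
  elim: n => [//|n IHn]; have [_ [k kE] _ _] := stS n.
  have sz : size (st n).2 = n by rewrite -IHn size_mkseq.
  by rewrite mkseqS IHn /t kE nth_rcons sz ltnn eqxx.
(* For [k > n] the point [g k] lies on a branch agreeing with [t] in its first [n.+1] coordinates,
   so a tail of the sequence lies in this closed set. *)
have Hy n : H (mkseq t n.+1) y.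
  apply: (@closed_cvg _ _ _ _ (i \o g) (H (mkseq t n.+1)) (@Hcl _) _ _ gy).
  exists n.+1 => // k /= nk; have [_ [u [uE uH]]] := gP k.
  have szk : size (st k).2 = k by rewrite -tE size_mkseq.
  rewrite (_ : mkseq t n.+1 = mkseq u n.+1); first exact: uH.
  apply: (@eq_from_nth _ 0%N); rewrite ?size_mkseq // => j jn.
  have jk : (j < k)%N by apply: leq_trans nk.
  by rewrite !nth_mkseq// -(@nth_mkseq _ 0%N t k j jk) tE -uE szk nth_mkseq.
(* The Souslin representation replaces completeness of [G]: the limit in [Y] comes from a point of
   [G]. *)
have : range i y by rewrite iH; exists t.
move=> [p _ py].
(* The limit is only known to lie in the closed ball, hence the doubled radius in the ball that
   avoids [F n]. *)
have pn n : dG (aq n).1 p <= (aq n).2.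
  have [aq0 _ _ _] := aqP n.
  apply/ler_addgt0Pr => e e0.
  have /cvg_ballP/(_ _ e0)[N _ NP] := gy.
  have := NP (maxn N n.+1) (leq_maxl _ _) => /= /(metric_ballP mY _ _ e0).
  have /(metric_ballP mG _ _ aq0) := gball n (maxn N n.+1) (leq_maxr _ _).
  rewrite -!iso py.
  have := dYT (i (aq n).1) (i (g (maxn N n.+1))) y.
  by rewrite (dYC (i (g _)) y); lra.
exists p; split=> [O|n]; last first.
  have [aq0 _ _ aqF] := aqP n; apply: aqF.
  by apply/(metric_ballP mG); [lra|have := pn n; lra].
move=> /nbhs_nradiusP[k kO].
have rk := @nradius_gt0 R k.
have [n nk] := @nradius_lt R (nradius k / 2) ltac:(lra).
exists (st n.+1).1.1; split; first by have [] := stV n.+1.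
apply: kO; apply/(metric_ballP mG) => //.
have [aq0 aqn sub _] := aqP n.
have /sub/(metric_ballP mG _ _ aq0) :
    ball (st n.+1).1.1 (nradius (st n.+1).1.2) (st n.+1).1.1.
  by apply: ballxx; apply: nradius_gt0.
by have := dGT p (aq n).1 (st n.+1).1.1; rewrite (dGC p (aq n).1); have := pn n; lra.
Qed.

End SouslinPieces.

(** * Separately continuous actions *)

(** Close [e] under choice functions for [Q]: the elements reached are values of finite terms, and
    such terms form a countable type. *)
Lemma countable_witnesses {T : choiceType} {I : countType} (e : T)
    (Q : I -> T -> T -> (nat -> T) -> Prop) :
  (forall j a b, exists w, Q j a b w) ->
  exists C : set T, [/\ countable C, C e &
    forall j a b, C a -> C b -> exists w, Q j a b w /\ forall n, C (w n)].
Proof.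
move=> Qw.
have /choice[w wP] : forall x : I * T * T, exists w, Q x.1.1 x.1.2 x.2 w.
  by move=> [[j a] b]; apply: Qw.
(* A node with a leaf [(j, n)] and two subtrees denotes the [n]-th witness for their values; every
   other tree denotes [e]. *)
pose fix ev (t : GenTree.tree (I * nat)) : T := match t with
  | GenTree.Node _ [:: GenTree.Leaf (j, n); t1; t2] => w (j, ev t1, ev t2) n
  | _ => e end.
exists (range ev); split.
- exact: card_le_trans (card_image_le _ _) (countableP _).
- by exists (GenTree.Node 0 [::]).
move=> j _ _ [t1 _ <-] [t2 _ <-]; exists (w (j, ev t1, ev t2)); split.
  exact: (wP (j, ev t1, ev t2)).
by move=> n; exists (GenTree.Node 0 [:: GenTree.Leaf (j, n); t1; t2]).
Qed.

Section ClosedEq.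
Context {R : realType} {X : pseudoMetricType R} {dX : X -> X -> R}.
Hypothesis mX : metric_for dX.

Lemma closed_eq_continuous {S : topologicalType} (f g : S -> X) :
  continuous f -> continuous g -> closed [set s | f s = g s].
Proof.
move=> cf cg s cs; apply: (metric_eq0 mX) => r r0.
have W : nbhs s (f @^-1` (ball (f s) (r / 2)) `&` g @^-1` (ball (g s) (r / 2))).
  by apply: filterI; [apply: cf|apply: cg]; apply: nbhsx_ballx; rewrite divr_gt0.
have [t [/= ft [fs gs]]] := cs _ W.
apply: (@ball_splitl _ _ (g t)); last by [].
by rewrite -ft.
Qed.

End ClosedEq.

Section Action.
Set Implicit Arguments. Unset Strict Implicit. Unset Printing Implicit Defensive.
Context {R : realType} {X : pseudoMetricType R} {dX : X -> X -> R}.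
Context {G : pseudoMetricType R} {dG : G -> G -> R}.
Context {mul : G -> G -> G} {inv : G -> G} {e : G} {phi : G -> X -> X}.
Hypotheses (mX : metric_for dX) (mG : metric_for dG) (hgrp : is_group mul inv e).
Hypotheses (hri : right_invariant mul dG) (hact : is_action mul e phi).
Hypotheses (hsep : separately_continuous phi) (htr : transitive_action phi).

Lemma phi1 x : phi e x = x. Proof. exact: hact.1. Qed.
Lemma phiM g h x : phi (mul g h) x = phi g (phi h x). Proof. exact: hact.2. Qed.

Lemma phiVK g : cancel (phi g) (phi (inv g)).
Proof. by move=> x; rewrite -phiM; case: hgrp => _ _ _ -> _; rewrite phi1. Qed.

Lemma phiKV g : cancel (phi (inv g)) (phi g).
Proof. by move=> x; rewrite -phiM; case: hgrp => _ _ _ _ ->; rewrite phi1. Qed.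

Lemma mulgK g h : mul (mul g h) (inv h) = g.
Proof. by case: hgrp => A _ g1 _ V; rewrite -A V g1. Qed.

Lemma mulgKV g h : mul (mul g (inv h)) h = g.
Proof. by case: hgrp => A _ g1 V _; rewrite -A V g1. Qed.

Lemma ball_mulr g h k (r : R) : 0 < r -> ball (mul g k) r (mul h k) <-> ball g r h.
Proof. by move=> r0; rewrite !(metric_ballP mG) // hri. Qed.

Lemma ball_divr g h (r : R) : 0 < r -> ball g r h <-> ball e r (mul h (inv g)).
Proof.
move=> r0; rewrite -(ball_mulr g h (inv g)) //.
by case: hgrp => _ _ _ _ ->.
Qed.

Lemma ball_inv g (r : R) : 0 < r -> ball e r g -> ball e r (inv g).
Proof.
move=> r0 eg; rewrite -(ball_mulr _ _ g) //.
by case: hgrp => _ g1 _ -> _; rewrite g1; apply: ball_sym.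
Qed.

Lemma ball_translate g c (r : R) : 0 < r -> ball e r c -> ball g r (mul c g).
Proof. by move=> r0 ec; rewrite ball_divr // mulgK. Qed.

(* Although inversion need not be continuous, [v^-1 z = v0^-1 (v0 v^-1) z] and
   [v0 v^-1] is as close to [e] as [v] is to [v0]. *)
Lemma continuous_phiV z : continuous (fun v => phi (inv v) z).
Proof.
move=> v B Bv.
have : nbhs (phi e z) (phi (inv v) @^-1` B) by apply: (hsep.1 (inv v)); rewrite phi1.
move=> /(hsep.2 z) /nbhs_nradiusP[k kB].
apply/nbhs_nradiusP; exists k => v' vv'.
have r0 := @nradius_gt0 R k.
have /kB /= : ball e (nradius k) (mul v (inv v')).
  by apply: (ball_divr _ _ r0).1; apply: ball_sym.
by rewrite -!phiM; case: hgrp => -> g1 _ -> _; rewrite g1.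
Qed.

Lemma nowhere_dense_phi g A : nowhere_dense A -> nowhere_dense (phi g @^-1` A).
Proof.
by apply: nowhere_dense_preimage (phiVK g) (phiKV g); apply: hsep.1.
Qed.

Lemma meagre_phi g A : meagre (phi g @` A) -> meagre A.
Proof.
move=> mA; apply: (@meagre_sub _ _ (phi g @^-1` (phi g @` A))).
  exact: preimage_image.
by apply: meagre_preimage (phiVK g) (phiKV g) mA; apply: hsep.1.
Qed.

Definition fat (z : X) : Prop := forall r : R, 0 < r -> ~ meagre (orbit_of phi (ball e r) z).

Lemma orbit_ball g x (r : R) : 0 < r ->
  orbit_of phi (ball g r) x = orbit_of phi (ball e r) (phi g x).
Proof.
move=> r0; rewrite eqEsubset; split=> _ [u ur <-].
  exists (mul u (inv g)); first by apply: (ball_divr _ _ r0).1.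
  by rewrite -phiM mulgKV.
by exists (mul u g); [apply: ball_translate|rewrite phiM].
Qed.

(** With [v = c^-1 g] one has [v^-1 z = g^-1 c z], and [v] is near [g] when [c] is near [e]. So the
    set contains the image of a non-meagre orbit piece under a homeomorphism. *)
Lemma fat_inverse_orbit z g (r : R) : fat z -> 0 < r ->
  ~ meagre [set phi (inv v) z | v in ball g r].
Proof.
move=> fz r0 m; apply: (fz r r0); apply: (@meagre_phi (inv g)).
apply: meagre_sub m => _ [_ [c ec <-] <-].
exists (mul (inv c) g); first by apply: ball_translate => //; apply: ball_inv.
by rewrite -[X in phi (inv (mul _ _)) X](phiVK c) -{1}(phiKV g (phi c z)) -(phiM (inv c) g) phiVK.
Qed.

Hypothesis hbsd : forall x : X, base_sigma_discrete (fun g : G => phi g x).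

(** By transitivity these points form the image of [A] under one evaluation map. Near each [a] in
    [A] that image lies in a meagre orbit piece, by right invariance, so localization applies. *)
Lemma meagre_not_fat : meagre [set x | ~ fat x].
Proof.
have [[x0 _]|nX] := pselect ([set: X] !=set0); last first.
  by apply: meagre_sub (@meagre0 _) => x _; apply: nX; exists x.
pose A := [set g | ~ fat (phi g x0)].
apply: (@meagre_sub _ _ ((fun g => phi g x0) @` A)).
  by move=> x nx; have [g gx] := htr x0 x; exists g; rewrite // /A /= gx.
apply: (meagre_localization mG) => // a.
move=> /existsNP[r /not_implyP[r0 /contrapT mr]]; exists r => //.
apply: meagre_sub mr; rewrite -orbit_ball //.
by move=> _ [u [_ au] <-]; exists u.
Qed.

(* An uncountable set of this kind would have an uncountable image in the
   separable closure of the orbit of [C], yet that image is sigma-discrete. *)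
Lemma separated_countable (C J : set G) (d : G) (x : X) (eps : R) :
  0 < eps -> countable C -> J `<=` closure C ->
  (forall p q, J p -> J q -> p <> q ->
     ~ ball (mul d p) eps (mul d q) /\ phi p x <> phi q x) ->
  countable J.
Proof.
move=> eps0 cC JC sepJ.
pose y p := phi (mul d p) x.
have y_inj p q : J p -> J q -> y p = y q -> p = q.
  move=> Jp Jq; rewrite /y !phiM => /(congr1 (phi (inv d))); rewrite !phiVK => pq.
  by apply: contrapT => npq; have [_] := sepJ p q Jp Jq npq.
pose E := [set [set mul d p] | p in J].
have dE : discrete_family E.
  move=> g; exists (ball g (eps / 2)).
    by apply: nbhsx_ballx; rewrite divr_gt0.
  move=> _ _ [p Jp <-] [q Jq <-] [_ [-> gp]] [_ [-> gq]].
  apply: contrapT => npq.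
  have [|nb _] := sepJ p q Jp Jq; first by move=> pq; apply: npq; rewrite pq.
  by apply: nb; apply: (@ball_splitr _ _ g).
have [B [Bn [dBn BE]] bE] := hbsd x dE.
(* A base for singletons must contain each of them, so the singletons [[set y p]] are themselves
   split into countably many discrete families. *)
have JB : J `<=` \bigcup_n [set p | J p /\ Bn n [set y p]].
  move=> p Jp; have [|B0 B0B BpE] := bE [set y p].
    by exists [set mul d p]; [exists p|rewrite image_set1].
  have : [set y p] (y p) by [].
  rewrite BpE => -[S B0S Sy].
  have SE : S = [set y p].
    rewrite eqEsubset; split=> [s Ss|_ ->//]; rewrite BpE; by exists S.
  by move: (B0B _ B0S); rewrite BE SE => -[n _ Bny]; exists n.
apply: sub_countable (subset_card_le JB) _; apply: bigcup_countable => // n _.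
(* Attach to [p] a radius isolating [y p] within its discrete family and a point of [C] whose image
   is within half of it; this pair determines [p]. *)
have /choice[c cP] : forall p, exists c : G * nat, J p /\ Bn n [set y p] ->
   [/\ C c.1, ball (y p) (nradius c.2 / 2) (phi d (phi c.1 x)) &
     forall q, J q -> Bn n [set y q] -> ball (y p) (nradius c.2) (y q) -> p = q].
  move=> p; have [[Jp Bp]|np] := pselect (J p /\ Bn n [set y p]); last first.
    by exists (e, 0%N).
  have [V Vy VB] := dBn n (y p).
  have /nbhs_nradiusP[k kV] := Vy.
  have W : nbhs p ((fun g => phi d (phi g x)) @^-1` ball (y p) (nradius k / 2)).
    have : nbhs (phi p x) (phi d @^-1` ball (y p) (nradius k / 2)).
      apply: (hsep.1 d); rewrite /y phiM; apply: nbhsx_ballx.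
      by rewrite divr_gt0 ?nradius_gt0.
    by move=> /(hsep.2 x).
  have [g [Cg gb]] := JC p Jp _ W.
  exists (g, k) => _; split=> // q Jq Bq pq.
  apply: y_inj => //.
  have : [set y p] = [set y q].
    apply: VB => //; first by exists (y p); split=> //; apply: nbhs_singleton.
    by exists (y q); split=> //; apply: kV.
  by move=> /seteqP[/(_ _ erefl)].
have /countable_injP[f f_inj] := countableX cC (countableP [set: nat]).
apply/countable_injP; exists (f \o c) => p q; rewrite !inE => pP qP.
have [Cp pb pq] := cP p pP; have [Cq qb _] := cP q qP.
move=> /= /f_inj cpq; have {}cpq : c p = c q by apply: cpq; rewrite inE.
apply: pq; [by case: qP|by case: qP|].
by apply: (ball_splitl pb); rewrite cpq.
Qed.

End Action.

(** * Analytic groups *)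

Lemma countable_setU {T : Type} (A B : set T) :
  countable A -> countable B -> countable (A `|` B).
Proof.
move=> cA cB; rewrite (_ : _ `|` _ = \bigcup_b (if b then A else B)).
  by apply: bigcup_countable => // -[].
rewrite eqEsubset; split=> [x [Ax|Bx]|x [[] _ ?]]; by [exists true|exists false|left|right].
Qed.

Section AnalyticAction.
Set Implicit Arguments. Unset Strict Implicit. Unset Printing Implicit Defensive.
Context {R : realType} {X : pseudoMetricType R} {dX : X -> X -> R}.
Context {G : pseudoMetricType R} {dG : G -> G -> R}.
Context {mul : G -> G -> G} {inv : G -> G} {e : G} {phi : G -> X -> X}.
Hypotheses (mX : metric_for dX) (mG : metric_for dG) (hgrp : is_group mul inv e).
Hypotheses (hri : right_invariant mul dG) (hact : is_action mul e phi).
Hypotheses (hsep : separately_continuous phi) (htr : transitive_action phi).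
Hypothesis hbsd : forall x : X, base_sigma_discrete (fun g : G => phi g x).

Lemma nradius_anti m n : (m <= n)%N -> (nradius n : R) <= nradius m.
Proof. by move=> mn; rewrite /nradius lef_pV2 ?posrE ?ltr0n // ler_nat. Qed.

Lemma orbit_not_nowhere_dense w (r : R) : ~ meagre [set: X] -> @baire_space G ->
  analytic_metric dG -> 0 < r -> ~ nowhere_dense (orbit_of phi (ball e r) w).
Proof.
move=> nmX hbaire [Y [dY [i [mY [iso [H [Hcl iH]]]]]]] r0 wr.
have mbad := meagre_not_fat mG hgrp hri hact htr hbsd.
have [z fz] : exists z, fat (e := e) (phi := phi) z.
  by apply: contrapT => nf; apply: nmX; apply: meagre_sub mbad => x _ fx; apply: nf; exists x.
have [d dz] := htr z w.
pose M := phi d @^-1` closure (orbit_of phi (ball e r) w).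
have Mcl : closed M.
  by apply: preimage_closed; [move=> ? _; apply: hsep.1|apply: closed_closure].
have mM : meagre M.
  apply: nowhere_dense_meagre.
  apply: (nowhere_dense_phi hgrp hact hsep).
  by rewrite /nowhere_dense -((closure_id _).1 (@closed_closure _ _)).
have point_meagre (x : X) : meagre [set x].
  have [g gx] := htr x w; apply: nowhere_dense_meagre.
  apply: (nowhere_dense_sub _ (nowhere_dense_phi hgrp hact hsep g wr)) => _ ->.
  by exists e; [apply: ballxx|rewrite /= (phi1 hact)].
have nmD g h (s : R) : 0 < s -> ~ meagre (phi g @` [set phi (inv v) z | v in ball h s]).
  move=> s0 /(meagre_phi hgrp hact hsep).
  exact: (fat_inverse_orbit mG hgrp hri hact hsep).
pose L := large (i := i) (H := H).
(* Witnesses 0 and 1 will make the sets [L1] thin, witnesses 2 and 3 the sets [K], and witness 4 is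
   the centre that extends a large piece. *)
have [C [cC Ce CQ]] : exists C : set G, [/\ countable C, C e &
  forall (j : nat * seq nat) a b, C a -> C b -> exists w,
    [/\ [/\ ball a (nradius j.1 : R) (w 0%N), ball b (nradius j.1 : R) (w 1%N) &
       ~ M (phi (w 0%N) (phi (inv (w 1%N)) z))],
    [/\ ball a (nradius j.1 : R) (w 2%N), ball b (nradius j.1 : R) (w 3%N) &
       phi (w 2%N) (phi (inv (w 3%N)) z) <> phi a (phi (inv (w 3%N)) z)] &
    L j.2 (ball a (nradius j.1)) -> exists k m,
       ball (w 4%N) (nradius m : R) `<=` ball a (nradius j.1) /\
       L (rcons j.2 k) (ball (w 4%N) (nradius m))] /\ forall n, C (w n)].
  apply: countable_witnesses => -[m s] a b /=.
  have m0 := @nradius_gt0 R m.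
  have [w1 [bw1 nw1]] : exists w1, ball b (nradius m) w1 /\ ~ M (phi a (phi (inv w1) z)).
    apply: contrapT => nw; apply: (nmD a b _ m0); apply: meagre_sub mM.
    move=> _ [_ [v bv <-] <-]; apply: contrapT => nM; apply: nw; by exists v.
  (* Otherwise every [a v^-1 z] with [v] near [b] would have a one-point orbit piece and fail to be
     fat, although these points form a non-meagre set. *)
  have [w2 [w3 [aw2 bw3 ne23]]] : exists w2 w3, [/\ ball a (nradius m) w2,
      ball b (nradius m) w3 & phi w2 (phi (inv w3) z) <> phi a (phi (inv w3) z)].
    apply: contrapT => nw; apply: (nmD a b _ m0); apply: meagre_sub mbad.
    move=> _ [_ [v bv <-] <-] fx; apply: (fx _ m0).
    apply: meagre_sub (point_meagre (phi a (phi (inv v) z))) => _ [c ec <-].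
    apply: contrapT => ne; apply: nw; exists (mul c a), v; split=> //.
      exact: (ball_translate mG hgrp hri).
    by rewrite (phiM hact).
  have [[k [w4 [m' w4P]]]|nL] := pselect (exists k a' m',
      ball a' (nradius m' : R) `<=` ball a (nradius m) /\
      L (rcons s k) (ball a' (nradius m'))).
    exists (fun n => nth e [:: a; w1; w2; w3; w4] n); split=> //=.
      by split=> //; apply: ballxx.
    by move=> _; exists k, m'.
  exists (fun n => nth e [:: a; w1; w2; w3; e] n); split=> //=.
    by split=> //; apply: ballxx.
  by move=> ls; exfalso; apply: nL; apply: (large_extend mG m0 ls).
have CL c m s : C c -> L s (ball c (nradius m)) -> exists k c' m',
    [/\ C c', ball c' (nradius m') `<=` ball c (nradius m) &
      L (rcons s k) (ball c' (nradius m'))].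
  move=> Cc lc; have [v [[_ _ vL] vC]] := CQ (m, s) c c Cc Cc.
  by have [k [m' [? ?]]] := vL lc; exists k, (v 4%N), m'.
have avoid (FF : set (set G)) : countable FF -> (forall F, FF F -> thin (R := R) (C := C) F) ->
    exists p, closure C p /\ forall F, FF F -> ~ F p.
  move=> /countable_injP[f f_inj] tFF.
  (* An injection into [nat] enumerates [FF]; indices outside its range receive the empty set. *)
  have /choice[Fn FnP] : forall n, exists F, (FF F /\ f F = n) \/
      (F = set0 /\ forall F', FF F' -> f F' <> n).
    move=> n; have [[F [FFF fF]]|nF] := pselect (exists F, FF F /\ f F = n).
      by exists F; left.
    by exists set0; right; split=> // F' FF' fF'; apply: nF; exists F'.
  have [|p [Cp pF]] := thin_avoidance mG mY iso Hcl iH hbaire Ce CL (F := Fn).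
    move=> n; have [[/tFF//]|[-> _]] := FnP n; split; first exact: closed0.
    by move=> c m Cc; exists c; split=> //; apply: ballxx; apply: nradius_gt0.
  exists p; split=> // F FFF Fp; apply: (pF (f F)).
  have [[FFn fFn]|[_ /(_ F FFF)//]] := FnP (f F).
  by rewrite (f_inj (Fn (f F)) F) // inE.
have CN : countable (C `*` [set: nat]) by apply: countableX.
have cphiV : continuous (fun v => phi (inv v) z).
  exact: (continuous_phiV mG hgrp hri hact hsep).
(* The point [h] is chosen so that evaluation at [h^-1 z] is constant on no relative ball of [C];
   [K (c, m)] collects the [h] for which it is constant on one such ball. *)
have [h [Ch hK]] : exists h, closure C h /\ forall c m, C c -> exists c',
    [/\ C c', ball c (nradius m : R) c' & phi c' (phi (inv h) z) <> phi c (phi (inv h) z)].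
  pose K (x : G * nat) := \bigcap_(c in [set c | C c /\ ball x.1 (nradius x.2 : R) c])
    [set h | phi c (phi (inv h) z) = phi x.1 (phi (inv h) z)].
  have [|_ [[c m] [/= Cc _] <-]|h [Ch hK]] := avoid (K @` (C `*` [set: nat])).
  - exact: card_le_trans (card_image_le _ _) CN.
  - split.
      apply: closed_bigI => c' _; apply: (closed_eq_continuous mX).
        by move=> x; apply: continuous_comp; [exact: cphiV|exact: hsep.1].
      by move=> x; apply: continuous_comp; [exact: cphiV|exact: hsep.1].
    move=> b m' Cb.
    (* The index [maxn m m'] gives a radius no larger than either required one. *)
    have [v [[_ [v2 v3 v23] _] vC]] := CQ (maxn m m', [::]) c b Cc Cb.
    exists (v 3%N); split=> //.
      by apply: le_ball v3; apply: nradius_anti; apply: leq_maxr.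
    move=> Kv; apply: v23; apply: Kv; split=> //.
    by apply: le_ball v2; apply: nradius_anti; apply: leq_maxl.
  exists h; split=> // c m Cc; apply: contrapT => nc.
  apply: (hK (K (c, m))); first by exists (c, m).
  by move=> c' [Cc' cc']; apply: contrapT => ne; apply: nc; exists c'.
pose x := phi (inv h) z.
have thin_fibre y : thin (R := R) (C := C) [set p | phi p x = y].
  split.
    apply: (closed_eq_continuous mX); first exact: hsep.2.
    by move=> ?; apply: cvg_cst.
  move=> c m Cc; have [cy|cy] := pselect (phi c x = y); last first.
    by exists c; split=> //; apply: ballxx; apply: nradius_gt0.
  have [c' [Cc' cc' ne]] := hK c m Cc.
  by exists c'; split=> //= c'y; apply: ne; rewrite -/x c'y cy.
(* These are the [v] for which [N v] below contains a whole relative ball of [C]; avoiding all of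
   them makes [N v] thin. *)
pose L1 (a : G * nat) := \bigcap_(c in [set c | C c /\ ball a.1 (nradius a.2 : R) c])
  [set v | M (phi c (phi (inv v) z))].
have thinL1 F : (L1 @` (C `*` [set: nat])) F -> thin (R := R) (C := C) F.
  move=> [[c m] [/= Cc _] <-]; split.
    apply: closed_bigI => c' _; apply: preimage_closed Mcl.
    by move=> y _; apply: continuous_comp; [exact: cphiV|exact: hsep.1].
  move=> b m' Cb.
  have [v [[[v0 v1 v01] _ _] vC]] := CQ (maxn m m', [::]) c b Cc Cb.
  exists (v 1%N); split=> //.
    by apply: le_ball v1; apply: nradius_anti; apply: leq_maxr.
  move=> Lv; apply: v01; apply: Lv; split=> //.
  by apply: le_ball v0; apply: nradius_anti; apply: leq_maxl.
pose P := [set v | closure C v /\ forall F, (L1 @` (C `*` [set: nat])) F -> ~ F v].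
pose N v := [set p | M (phi p (phi (inv v) z))].
have thinN v : P v -> thin (R := R) (C := C) (N v).
  move=> [_ vL]; split; first by apply: preimage_closed Mcl => ? _; apply: hsep.2.
  move=> c m Cc; apply: contrapT => nc; apply: (vL (L1 (c, m))); first by exists (c, m).
  by move=> c' [Cc' cc']; apply: contrapT => nM; apply: nc; exists c'.
pose Sep J := J `<=` P /\ forall p q, J p -> J q -> p <> q ->
  ~ ball (mul d p) r (mul d q) /\ phi p x <> phi q x.
have [|J [[JP Jsep] Jmax]] := @Zorn_bigcup _ Sep.
  move=> FF FFS tot; split=> [p [J FJ Jp]|p q [J FJ Jp] [J' FJ' J'q]].
    exact: (FFS J FJ).1.
  have [JJ'|J'J] := tot J J' FJ FJ'.
    by apply: (FFS J' FJ').2 => //; apply: JJ'.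
  by apply: (FFS J FJ).2 => //; apply: J'J.
have cJ : countable J.
  apply: (separated_countable hgrp hact hsep hbsd r0 cC _ Jsep).
  by move=> p /JP[].
(* Avoiding the [L1] sets puts [p] in [P], avoiding the [N q] separates [d p] from every [d q], and
   avoiding the fibres makes [p x] new. *)
have [||p [Cp pF]] := avoid (L1 @` (C `*` [set: nat]) `|` (N @` J `|`
   (fun q => [set p | phi p x = phi q x]) @` J)).
- by apply: countable_setU; [|apply: countable_setU];
    apply: card_le_trans (card_image_le _ _) _.
- by move=> F [/thinL1//|[[q /JP Pq <-]|[q _ <-]]]; [apply: thinN|apply: thin_fibre].
have Pp : P p by split=> // F LF; apply: pF; left.
have pN q : J q -> ~ N q p by move=> Jq; apply: pF; right; left; exists q.
have px q : J q -> phi p x <> phi q x.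
  move=> Jq; apply: (pF [set p' | phi p' x = phi q x]); right; right; by exists q.
(* If [d p] is close to [d q], then [d p q^-1 z = (d p) (d q)^-1 w] lies in the orbit piece of [w],
   so [p] is in [N q]. *)
have pdq q : J q -> ~ ball (mul d q) r (mul d p).
  move=> Jq dqp; apply: (pN q Jq); apply: subset_closure.
  exists (mul (mul d p) (inv (mul d q))).
    exact: (ball_divr mG hgrp hri _ _ r0).1.
  rewrite -dz -{1}(phiKV hgrp hact q z) -(phiM hact d q) (phiM hact (mul d p)).
  by rewrite (phiVK hgrp hact) (phiM hact).
apply: (Jmax (J `|` [set p])).
  split; first by left.
  move=> /(_ p (or_intror erefl)) Jp; exact: px p Jp erefl.
split=> [q [/JP//|->//]|a b [Ja|->] [Jb|->]]; [exact: Jsep| | |by []].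
- by move=> _; split; [exact: pdq|move=> /esym; exact: px].
- by move=> _; split; [move=> /ball_sym; exact: pdq|exact: px].
Qed.

End AnalyticAction.

(** * Shift-compactness *)

Theorem theoremS (R : realType)
  (X : pseudoMetricType R) (dX : X -> X -> R) (hdX : metric_for dX)
  (T : set X) (hT : ~ meagre T) (hTb : baire_prop T)
  (G : pseudoMetricType R) (dG : G -> G -> R) (hdG : metric_for dG)
  (mul : G -> G -> G) (inv : G -> G) (e : G) (hgrp : is_group mul inv e)
  (hri : right_invariant mul dG) (hbaire : @baire_space G)
  (phi : G -> X -> X) (hact : is_action mul e phi)
  (hsep : separately_continuous phi) (htr : transitive_action phi)
  (hyp : nikodym_action e phi \/
         (analytic_metric dG /\ forall x : X, base_sigma_discrete (fun g : G => phi g x)))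
  (u : nat -> X) (x : X) (hu : u @ \oo --> x)
  (A : set G) (hA : ~ meagre A) (hAb : baire_prop A)
  (heA : quasi_interior A e)
  (hAT : orbit_of phi (quasi_interior A) x `&` quasi_interior T !=set0) :
  exists alpha : G, exists N : nat,
    [/\ A alpha, T (phi alpha x) & forall n : nat, (N < n)%N -> T (phi alpha (u n))].
Proof.
have orbit_nd w (r : R) : 0 < r -> ~ nowhere_dense (orbit_of phi (ball e r) w).
  move=> r0; case: hyp => [nik|[ana bsd]]; last first.
    apply: (orbit_not_nowhere_dense hdX hdG hgrp hri hact hsep htr bsd) => //.
    exact: contra_not (meagre_sub (@subsetT _ T)) hT.
  move=> /nowhere_dense_meagre mB.
  have [B BU [nB _]] := nik _ (open_metric_ball hdG _ r0) (ballxx e r0) w.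
  exact: nB (meagre_sub BU mB).
(* If the closure of the slice contains a ball about [g], the orbit map carries that ball into
   [closure F], and by right invariance its image is an orbit piece of [phi g v]. *)
have slice_nd v (F : set X) : nowhere_dense F -> nowhere_dense [set g | F (phi g v)].
  move=> F0; rewrite /nowhere_dense -subset0 => g gi.
  have /(nbhs_nradiusP g)[k kF] : nbhs g ((fun g => phi g v) @^-1` closure F).
    have cl : closed ((fun g => phi g v) @^-1` closure F).
      by apply: preimage_closed => [? _|]; [apply: hsep.2|apply: closed_closure].
    apply: filterS gi => q qc; rewrite ((closure_id _).1 cl).
    by apply: (closureS _ qc) => p; apply: (@subset_closure _ F (phi p v)).
  apply: (orbit_nd (phi g v) _ (@nradius_gt0 R k)).
  rewrite -(orbit_ball hdG hgrp hri hact) ?nradius_gt0 //.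
  apply: (@nowhere_dense_sub _ _ (closure F)); first by move=> _ [q /kF ? <-].
  by rewrite /nowhere_dense -((closure_id _).1 (@closed_closure _ _)).
have [_ [[a [U [oU mU] Ua] <-] [W [oW [F [F0 WF]]] Wa]]] := hAT.
apply: contrapT => no_shift.
(* If no shift works, every [g] in this non-empty open set lies outside [A] or sends [x] or some
   [u n] into some [F k], which makes the set meagre. *)
apply: (hbaire (U `&` (fun g => phi g x) @^-1` W)).
- by apply: openI => //; apply: open_comp => // ? _; apply: hsep.2.
- by exists a.
pose bad v := \bigcup_k [set g | F k (phi g v)].
apply: (@meagre_sub _ _ ((U `\` A) `|` (bad x `|` \bigcup_n bad (u n)))); last first.
  have mbad v : meagre (bad v).
    by apply: meagre_bigcup => k; apply/nowhere_dense_meagre/slice_nd.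
  by apply: meagreU => //; apply: meagreU => //; apply: meagre_bigcup.
move=> g [Ug Wg]; have [Ag|nA] := pselect (A g); last by left.
right; have [Tx|nTx] := pselect (T (phi g x)); last first.
  by left; have [k _ Fk] := WF _ (conj Wg nTx); exists k.
right; have /hu[N _ NW] : nbhs x (phi g @^-1` W).
  by apply: hsep.1; apply: open_nbhs_nbhs.
apply: contrapT => ng; apply: no_shift; exists g, N; split=> // n Nn.
apply: contrapT => nT.
have [k _ Fk] := WF _ (conj (NW n (ltnW Nn)) nT).
by apply: ng; exists n => //; exists k.
Qed.
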